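(* Let $Q$ and $n$ be positive integers. Then $S_{Qn}(Qn)\equiv n \pmod{Qn}$ if and only if both of the following conditions hold: (i) for every prime $p$ dividing $Q$, we have $p-1\mid Qn$ and $\frac{Q}{p}+1\equiv 0\pmod{p}$; (ii) for every prime $p$ with $p\mid n$ and $p\nmid Q$, we have $p-1\nmid Qn$.
   Context: For positive integers $m,k$, $S_m(k):=1^m+2^m+\cdots+k^m$. *)

(* Defs.v *)
From mathcomp Require Import all_boot.

Set Implicit Arguments.
Unset Strict Implicit.
Unset Printing Implicit Defensive.

(* S_m(k) = 1^m + 2^m + ... + k^m; the first argument is the exponent. *)
Definition power_sum (m k : nat) : nat := \sum_(1 <= i < k.+1) i ^ m.

(* Main.v *)
Require Import Defs.
From mathcomp Require Import all_boot.
From mathcomp Require Import all_algebra cyclic finfield.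

(** If p^a divides N, then i^N modulo p^a depends only on i modulo p. Hence, with
    p^a the exact power of p in N, S_N(N) is congruent modulo p^a to N/p times
    the sum of the N-th powers over a full residue system modulo p. That sum is
    -1 or 0 modulo p according to whether p - 1 divides N, so S_N(N) is
    -N/p or 0 modulo p^a, and the theorem reduces to comparing p-adic valuations,
    prime by prime. *)

Lemma eqn_mod_partP (d m n : nat) : 0 < d ->
  m = n %[mod d] <-> (forall p, prime p -> p %| d -> m = n %[mod d`_p]).
Proof.
(* Natural subtraction is truncated, so a congruence becomes divisibility of [m - n] only when
   [n <= m]. *)
move=> d_gt0; wlog le_nm : m n / n <= m.
  move=> W; case/orP: (leq_total n m) => [/W // | /W [H1 H2]].
  split=> [/esym /H1 H p p_pr p_d | H]; first by rewrite H.
  by apply/esym/H2 => p p_pr p_d; rewrite H.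
split=> [mn p _ _ | H].
  apply/eqP; rewrite eqn_mod_dvd //; apply: dvdn_trans (dvdn_part p d) _.
  by rewrite -eqn_mod_dvd //; apply/eqP.
apply/eqP; rewrite eqn_mod_dvd //; apply/dvdn_partP => // p.
rewrite mem_primes => /and3P[p_pr _ p_d].
by rewrite -eqn_mod_dvd //; apply/eqP/H.
Qed.

(** In [x ^ k - y ^ k = (x - y) * sum], the first factor is divisible by [d] and the second by
    [p]. *)
Lemma eqn_mod_exp_mul (p k d x y : nat) : p %| k -> p %| d ->
  x = y %[mod d] -> x ^ k = y ^ k %[mod p * d].
Proof.
move=> p_k p_d; wlog le_yx : x y / y <= x.
  move=> W; case/orP: (leq_total y x) => [/W // | /W H /esym xy].
  by apply/esym/H.
move=> xy; apply/eqP; rewrite eqn_mod_dvd; last first.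
  by case: (k) => // k'; rewrite leq_exp2r.
rewrite subn_exp [(x - y) * _]mulnC; apply: dvdn_mul; last first.
  by rewrite -eqn_mod_dvd //; apply/eqP.
have xyp : x = y %[mod p] by rewrite -(modn_dvdm x p_d) xy modn_dvdm.
(* Modulo [p] every [x] may be replaced by [y], so the cofactor becomes [k * y ^ k.-1], a multiple
   of [p]. *)
have -> : (p %| \sum_(i < k) x ^ (k.-1 - i) * y ^ i)
        = (p %| \sum_(i < k) y ^ k.-1).
  rewrite /dvdn -modn_summ -[in RHS]modn_summ.
  congr (_ %% _ == 0); apply: eq_bigr => i _.
  rewrite -modnMml -modnXm xyp modnXm modnMml -expnD subnK //.
  by rewrite -ltnS (ltn_predK (ltn_ord i)).
by rewrite sum_nat_const card_ord dvdn_mulr.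
Qed.

(** Each of the [a] successive [p]-th powers gains one factor [p] in the modulus; the remaining
    factor of [k] preserves the congruence. *)
Lemma eqn_mod_exp_pfactor (p a k x y : nat) : p ^ a %| k ->
  x = y %[mod p] -> x ^ k = y ^ k %[mod p ^ a.+1].
Proof.
move=> /dvdnP[c ->] xy; rewrite mulnC !expnM -modnXm.
suff -> : x ^ (p ^ a) = y ^ (p ^ a) %[mod p ^ a.+1] by rewrite modnXm.
elim: a => [|a IHa]; first by rewrite expn0 !expn1.
rewrite [in x ^ _]expnSr [in y ^ _]expnSr !expnM [in RHS]expnS [in LHS]expnS.
by apply: eqn_mod_exp_mul => //; rewrite expnS dvdn_mulr.
Qed.

Lemma modn_sum_periodic (f : nat -> nat) (d p K : nat) :
  (forall i j, i = j %[mod p] -> f i = f j %[mod d]) ->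
  \sum_(0 <= i < K * p) f i = K * \sum_(0 <= i < p) f i %[mod d].
Proof.
move=> f_per; elim: K => [|K IHK]; first by rewrite !mul0n big_geq.
rewrite mulSn addnC (big_cat_nat (n := K * p)) ?leq_addr //= -modnDml IHK modnDml.
rewrite [in RHS]mulSn [in RHS]addnC -modnDmr -[in RHS]modnDmr.
congr ((_ + _) %% _).
rewrite -{1}[K * p]add0n big_addn addKn -modn_summ -[in RHS]modn_summ.
by congr (_ %% _); apply: eq_bigr => i _; apply: f_per; rewrite addnC modnMDl.
Qed.

(** By Fermat the [p - 1] terms with [i > 0] are all 1 modulo [p], and the term at 0 vanishes
    because [m > 0]. *)
Lemma dvdn_sum_exp_succ (p m : nat) : prime p -> 0 < m -> p - 1 %| m ->
  p %| (\sum_(0 <= i < p) i ^ m).+1.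
Proof.
move=> p_pr m_gt0 /dvdnP[c m_eq]; have p_gt0 := prime_gt0 p_pr.
rewrite big_ltn // exp0n // add0n -addn1 /dvdn -modnDml -modn_summ.
rewrite (eq_big_nat _ _ (F2 := fun=> 1 %% p)); last first.
  move=> i /andP[i_gt0 lt_ip]; rewrite m_eq mulnC expnM -modnXm.
  have cop : coprime i p.
    by rewrite coprime_sym prime_coprime // gtnNdvd.
  have := Euler_exp_totient cop.
  by rewrite totient_prime // -subn1 => ->; rewrite modnXm exp1n.
by rewrite modn_summ sum_nat_const_nat muln1 modnDml subnK // modnn.
Qed.

Lemma exp_ne1_exists (p m : nat) : prime p -> ~~ (p - 1 %| m) ->
  exists2 g : 'F_p, g != 0%R & (g ^+ m != 1)%R.
Proof.
move=> p_pr p_m; have p_gt1 := prime_gt1 p_pr.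
have r_gt0 : 0 < m %% (p - 1) by rewrite lt0n.
have Fermat (x : 'F_p) : x != 0%R -> (x ^+ (p - 1) = 1)%R.
  move=> x_neq0; apply: (GRing.mulfI x_neq0).
  rewrite -GRing.exprS subn1 prednK ?prime_gt0 // GRing.mulr1.
  by have := expf_card x; rewrite card_Fp.
case: (pickP [pred g : 'F_p | (g != 0%R) && (g ^+ m != 1)%R]) => [g /andP[]|none].
  by exists g.
exfalso.
(* If every nonzero [x] had [x ^+ m = 1], this nonzero polynomial of degree less than [p - 1] would
   have [p - 1] roots. *)
set P := ('X^(m %% (p - 1)) - 1)%R : {poly 'F_p}.
have szP : size P = (m %% (p - 1)).+1 by rewrite size_XnsubC.
have P_neq0 : P != 0%R by rewrite -size_poly_eq0 szP.
have := @max_poly_roots _ P (enum (predC1 (0%R : 'F_p))) P_neq0.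
have -> : all (root P) (enum (predC1 (0%R : 'F_p))).
  apply/allP => x; rewrite mem_enum inE => x_neq0.
  have := none x; rewrite /= x_neq0 /= => /negbFE /eqP.
  rewrite {1}(divn_eq m (p - 1)) GRing.exprD mulnC GRing.exprM Fermat //.
  rewrite GRing.expr1n GRing.mul1r => xm.
  by rewrite rootE !hornerE xm GRing.subrr.
rewrite enum_uniq => /(_ isT isT).
rewrite szP ltnS -cardE cardC1 card_Fp // -subn1.
by rewrite leqNgt ltn_mod subn_gt0 p_gt1.
Qed.

(** Multiplication by [g] permutes ['F_p], so the sum [s] satisfies [s = g ^+ m * s]; choosing
    [g ^+ m != 1] forces [s = 0]. *)
Lemma dvdn_sum_exp (p m : nat) : prime p -> ~~ (p - 1 %| m) ->
  p %| \sum_(0 <= i < p) i ^ m.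
Proof.
move=> p_pr p_m; have [g g_neq0 gm_neq1] := exp_ne1_exists p m p_pr p_m.
have chFp := pchar_Fp p_pr.
rewrite (GRing.dvdn_pcharf chFp) GRing.natr_sum big_mkord.
have -> : (\sum_(i < p) (i ^ m)%:R = \sum_(x : 'F_p) x ^+ m :> 'F_p)%R.
  (* The ordinal bound hidden in ['F_p] equals [p] only propositionally, so the index range is
     transported. *)
  have sum_cast q : q = p ->
      (\sum_(i < q) (i ^ m)%:R = \sum_(i < p) (i ^ m)%:R :> 'F_p)%R by move->.
  rewrite -(sum_cast _ (Fp_cast p_pr)); apply: eq_bigr => x _.
  by rewrite GRing.natrX natr_Zp.
set s := (\sum_x _)%R.
have : (s = g ^+ m * s)%R.
  rewrite GRing.mulr_sumr {1}/s (reindex_inj (GRing.mulfI g_neq0)) /=.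
  by apply: eq_bigr => x _; rewrite GRing.exprMn.
move/eqP; rewrite -{1}[s]GRing.mul1r -GRing.subr_eq0 -GRing.mulrBl GRing.mulf_eq0.
by rewrite GRing.subr_eq0 eq_sym (negPf gm_neq1).
Qed.

Lemma power_sum_diag_part (p N : nat) : prime p -> 0 < N -> p %| N ->
  power_sum N N = N %/ p * \sum_(0 <= i < p) i ^ N %[mod N`_p].
Proof.
move=> p_pr N_gt0 p_N.
rewrite -modn_sum_periodic => [|i j ij]; last first.
  have pN : p ^ logn p N %| N by rewrite -p_part dvdn_part.
  (* The lifting lemma gives the congruence modulo one more power of [p] than is needed here. *)
  rewrite p_part -(modn_dvdm (i ^ N) (dvdn_exp2l p (leqnSn _))).
  by rewrite (eqn_mod_exp_pfactor _ _ _ _ _ pN ij) modn_dvdm // dvdn_exp2l.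
(* The range shifts from [1..N] to [0..N-1]: the term [N ^ N] is 0 modulo the [p]-part of [N], and
   [0 ^ N = 0]. *)
rewrite divnK // /power_sum big_nat_recr //= [in RHS]big_ltn // exp0n // add0n.
rewrite -modnDmr; suff /eqP -> : N`_p %| N ^ N by rewrite addn0.
by apply: dvdn_trans (dvdn_part p N) _; apply: dvdn_exp.
Qed.

Lemma power_sum_diag_dvd (p N : nat) : prime p -> 0 < N -> p %| N ->
  p - 1 %| N -> N`_p %| power_sum N N + N %/ p.
Proof.
move=> p_pr N_gt0 p_N p1_N.
rewrite /dvdn -modnDml power_sum_diag_part // modnDml addnC -mulnS -/(dvdn _ _).
apply: dvdn_trans (dvdn_part p N) _.
rewrite -{1}(divnK p_N); apply: dvdn_mul => //.
exact: dvdn_sum_exp_succ.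
Qed.

Lemma power_sum_diag_dvd0 (p N : nat) : prime p -> 0 < N -> p %| N ->
  ~~ (p - 1 %| N) -> N`_p %| power_sum N N.
Proof.
move=> p_pr N_gt0 p_N p1_N.
rewrite /dvdn power_sum_diag_part // -/(dvdn _ _).
apply: dvdn_trans (dvdn_part p N) _.
rewrite -{1}(divnK p_N); apply: dvdn_mul => //.
exact: dvdn_sum_exp.
Qed.

(** The condition at one prime: the known value of the power sum, [- N %/ p] or 0, is compared with
    [n] through [p]-adic valuations. *)
Lemma power_sum_diag_partP (p Q n : nat) : prime p -> 0 < Q -> 0 < n ->
  p %| Q * n ->
  power_sum (Q * n) (Q * n) = n %[mod (Q * n)`_p] <->
  (if p %| Q then (p - 1 %| Q * n) && (p %| Q %/ p + 1)
   else ~~ (p - 1 %| Q * n)).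
Proof.
move=> p_pr Q_gt0 n_gt0 p_N; set N := Q * n in p_N *.
have N_gt0 : 0 < N by rewrite muln_gt0 Q_gt0.
have lpp : logn p p = 1 by rewrite logn_prime ?eqxx.
have lN : logn p N = logn p Q + logn p n by rewrite lognM.
have part_dvd x : 0 < x -> (N`_p %| x) = (logn p N <= logn p x).
  by move=> x_gt0; rewrite p_part pfactor_dvdn.
case: (boolP (p - 1 %| N)) => p1_N.
  have local_eqn : power_sum N N = n %[mod N`_p] <-> N`_p %| n + N %/ p.
    have S0 := power_sum_diag_dvd _ _ p_pr N_gt0 p_N p1_N.
    split=> [E | D]; first by rewrite /dvdn -modnDml -E modnDml.
    apply/eqP; rewrite -(eqn_modDr (N %/ p)).
    by move: S0 D => /eqP -> /eqP ->.
  apply: (iff_trans local_eqn); case: ifP => p_Q /=.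
    have -> : n + N %/ p = n * (Q %/ p + 1).
      by rewrite /N mulnC -muln_divA // mulnDr muln1 addnC.
    (* After cancelling [logn p n], what remains is [logn p Q <= logn p (Q %/ p + 1)]. *)
    rewrite part_dvd ?muln_gt0 ?n_gt0 ?addn1 // lognM // lN addnC leq_add2l.
    have lQ : 0 < logn p Q by rewrite logn_gt0 mem_primes p_pr Q_gt0.
    split=> [le_l | p_Q1].
      by rewrite -[p]expn1 pfactor_dvdn // (leq_trans lQ).
    (* Conversely, [p] cannot divide both [Q %/ p] and its successor, so [logn p Q] is at most 1. *)
    suff /eqP : logn p (Q %/ p) = 0.
      rewrite logn_div // lpp subn_eq0 => /leq_trans; apply.
      by rewrite -pfactor_dvdn // expn1.
    apply/eqP; rewrite -leqn0 leqNgt logn_gt0 mem_primes !negb_and.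
    apply/orP; right; apply/orP; right; apply/negP => p_Qp.
    by move: p_Q1; rewrite -addn1 dvdn_addr // dvdn1 => /eqP p1; rewrite p1 in p_pr.
  (* With [p] prime to [Q], [n] absorbs the whole [p]-part of [N] while [N %/ p] falls one factor
     short, so the congruence fails. *)
  have N_n : N`_p %| n.
    rewrite part_dvd // lN (_ : logn p Q = 0) //.
    by apply/eqP; rewrite -leqn0 leqNgt logn_gt0 mem_primes p_Q !andbF.
  have Np_gt0 : 0 < N %/ p by rewrite divn_gt0 ?prime_gt0 //; apply: dvdn_leq.
  rewrite (dvdn_addr _ N_n) (part_dvd _ Np_gt0).
  rewrite logn_div // lpp.
  have lN0 : 0 < logn p N by rewrite logn_gt0 mem_primes p_pr N_gt0.
  by rewrite leqNgt subn1 prednK // leqnn.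
have local_eqn : power_sum N N = n %[mod N`_p] <-> N`_p %| n.
  have /eqP -> := power_sum_diag_dvd0 _ _ p_pr N_gt0 p_N p1_N.
  by split=> [/esym/eqP | /eqP].
apply: (iff_trans local_eqn).
(* The [p]-part of [Q * n] divides [n] exactly when [logn p Q = 0]. *)
rewrite part_dvd // lN -[X in _ <= X]add0n leq_add2r leqNgt.
by rewrite logn_gt0 mem_primes p_pr Q_gt0 /=; case: ifP.
Qed.

Theorem theorem2 (Q n : nat) (hQ : 0 < Q) (hn : 0 < n) :
  power_sum (Q * n) (Q * n) = n %[mod Q * n] <->
  (forall p : nat, prime p -> p %| Q ->
     (p - 1 %| Q * n) /\ Q %/ p + 1 = 0 %[mod p]) /\
  (forall p : nat, prime p -> p %| n -> ~ (p %| Q) ->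
     ~ (p - 1 %| Q * n)).
Proof.
have N_gt0 : 0 < Q * n by rewrite muln_gt0 hQ.
apply: (iff_trans (eqn_mod_partP _ _ _ N_gt0)).
split=> [H | [H1 H2] p p_pr p_N].
  split=> p p_pr p_dvd => [|/negP/negPf p_Q].
    have p_N : p %| Q * n by rewrite dvdn_mulr.
    have /(power_sum_diag_partP _ _ _ p_pr hQ hn p_N) := H p p_pr p_N.
    by rewrite p_dvd => /andP[-> /eqP ->]; rewrite mod0n.
  have p_N : p %| Q * n by rewrite dvdn_mull.
  have /(power_sum_diag_partP _ _ _ p_pr hQ hn p_N) := H p p_pr p_N.
  by rewrite p_Q => /negP.
apply/(power_sum_diag_partP _ _ _ p_pr hQ hn p_N); case: ifP => p_Q.
  by have [-> E] := H1 p p_pr p_Q; rewrite /dvdn E mod0n.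
by apply/negP/H2; rewrite ?p_Q //; move: p_N; rewrite Euclid_dvdM // p_Q.
Qed.
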